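(* Let $G=\mathbb{Z}_2\times D_8$. The set of odd integer group determinants for $G$ is $$A:=\{m(m+16k)\;:\;m,k\in\mathbb{Z},\ m\text{ odd}\},$$ and the set of even integer group determinants for $G$ is $\{2^{16}m\;:\;m\in\mathbb{Z}\}$.
   Context: $\mathbb{Z}_2$ is the cyclic group of order 2 and $D_8=\langle F,R\mid F^2=1,\ R^4=1,\ RF=FR^3\rangle$ is the dihedral group of order 8. For a finite group $G$ and integers $(a_g)_{g\in G}$, the group determinant of $\sum_{g\in G}a_g g\in\mathbb{Z}[G]$ is $\mathcal{D}_G\left(\sum_{g\in G}a_g g\right)=\det\left(a_{gh^{-1}}\right)_{g,h\in G}$, the determinant of the $|G|\times|G|$ matrix with rows and columns indexed by the elements of $G$ in the same order and $(g,h)$ entry $a_{gh^{-1}}$. The integer group determinants for $G$ are the integers of the form $\mathcal{D}_G(x)$ with $x\in\mathbb{Z}[G]$; an odd (even) integer group determinant is one that is an odd (even) integer. *)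

(* Defs.v *)
From mathcomp Require Import all_boot all_order all_algebra all_fingroup all_solvable.
Set Implicit Arguments.
Unset Strict Implicit.
Unset Printing Implicit Defensive.
Import GRing.Theory.
Local Open Scope ring_scope.

(* An element of Z[gT] is given by its coefficient family a : {ffun gT -> int}.
   Rows and columns are both indexed through the enumeration enum_val of gT. *)
Definition group_det (gT : finGroupType) (a : {ffun gT -> int}) : int :=
  \det (\matrix_(i < #|gT|, j < #|gT|)
          a (enum_val i * (enum_val j)^-1)%g).

Definition integer_group_det (gT : finGroupType) (d : int) : Prop :=
  exists a : {ffun gT -> int}, group_det a = d.

Definition even_int (d : int) : bool := (2 %| d)%Z.
Definition odd_int (d : int) : bool := ~~ even_int d.

(* The group law of 'Z_2 is addition, and 'D_8 is presented by
   x ^+ 4, y ^+ 2, x ^ y = x^-1 (Grp_2dihedral), that is, with R = x and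
   F = y, R * F = F * R ^+ 3. *)
Definition Z2xD8 : finGroupType := ('Z_2 * 'D_8)%type.

(* Main.v *)
(* An element of Z[Z_2 x D_8] is u + z v with u, v in Z[D_8], and its group
   determinant is D(u + v) D(u - v), where D is the D_8 determinant. The two
   arguments agree modulo 2, and this forces the two values of D to agree
   modulo 16: an odd determinant is m (m + 16 k). Moreover an even value of D is
   always divisible by 2 ^ 8. Conversely, explicit pairs of arguments congruent
   modulo 2 yield the values m and m + 16 k of D for any m = 1 mod 4, and the
   values 2 ^ 8 and 2 ^ 8 m for any m. *)
Require Import Defs.
From mathcomp Require Import all_boot all_order all_algebra all_fingroup all_solvable.
From mathcomp Require Import zify ring.
Set Implicit Arguments.
Unset Strict Implicit.
Unset Printing Implicit Defensive.
Import GRing.Theory.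
Local Open Scope ring_scope.

(** * Determinants under renumbering and of block matrices *)

Lemma det_mxsub_perm (R : comNzRingType) n (s : 'S_n) (A : 'M[R]_n) :
  \det (mxsub s s A) = \det A.
Proof.
have -> : mxsub s s A = row_perm s (col_perm s A).
  by apply/matrixP=> i j; rewrite !mxE.
rewrite row_permE col_permE !det_mulmx !det_perm odd_permV.
by rewrite mulrCA -signr_addb addbb mulr1.
Qed.

(** Passing from [enum_val] to [h] permutes rows and columns alike, so the two signs cancel. *)
Lemma group_det_reindex (gT : finGroupType) n (h : 'I_n -> gT)
    (a : {ffun gT -> int}) :
  bijective h ->
  group_det a = \det (\matrix_(i < n, j < n) a (h i * (h j)^-1)%g).
Proof.
move=> hbij; have cn : #|gT| = n by rewrite -(bij_eq_card hbij) card_ord.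
case: n / cn h hbij => h hbij.
have sI : injective (fun i => enum_rank (h i)).
  by move=> i j /enum_rank_inj/(bij_inj hbij).
rewrite /group_det -(det_mxsub_perm (perm sI)); congr (\det _).
by apply/matrixP=> i j; rewrite !mxE !permE !enum_rankK.
Qed.

(** Adding the second block row to the first, then subtracting the first block column from the
    second, makes the matrix block lower triangular. *)
Lemma det_block_swap (R : comNzRingType) n (A B : 'M[R]_n) :
  \det (block_mx A B B A) = \det (A + B) * \det (A - B).
Proof.
have dU (C : 'M[R]_n) : \det (block_mx 1%:M C 0 1%:M) = 1.
  by rewrite det_ublock !det1 mulr1.
have E : block_mx 1%:M 1%:M 0 1%:M *m block_mx A B B A *m
    block_mx 1%:M (- 1%:M) 0 1%:M = block_mx (A + B) 0 B (A - B).
  rewrite !mulmx_block !(mul1mx, mul0mx, mulmx1, mulmx0, mulmxN, addr0, add0r).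
  by rewrite [B + A]addrC addNr [- B + A]addrC.
by rewrite -(det_lblock _ B) -E !det_mulmx !dU mul1r mulr1.
Qed.

Lemma det_split (R : comNzRingType) n (F : nat -> nat -> R) :
  (forall i j, (i < n)%N -> (j < n)%N ->
     F (n + i)%N (n + j)%N = F i j /\ F (n + i)%N j = F i (n + j)%N) ->
  \det (\matrix_(i < n + n, j < n + n) F i j) =
  \det (\matrix_(i < n, j < n) (F i j + F i (n + j)%N)) *
  \det (\matrix_(i < n, j < n) (F i j - F i (n + j)%N)).
Proof.
move=> hF; rewrite -(submxK (\matrix_(i, j) _)).
set A := ulsubmx _; set B := ursubmx _.
have -> : dlsubmx (\matrix_(i < n + n, j < n + n) F i j) = B.
  by apply/matrixP=> i j; rewrite !mxE /=; case: (hF i j).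
have -> : drsubmx (\matrix_(i < n + n, j < n + n) F i j) = A.
  by apply/matrixP=> i j; rewrite !mxE /=; case: (hF i j).
rewrite det_block_swap.
have -> : A + B = \matrix_(i < n, j < n) (F i j + F i (n + j)%N).
  by apply/matrixP=> i j; rewrite !mxE.
suff -> : A - B = \matrix_(i < n, j < n) (F i j - F i (n + j)%N) by [].
by apply/matrixP=> i j; rewrite !mxE.
Qed.

(* Laplace expansion along the first two rows. *)
Lemma det4E (R : comNzRingType) (F : nat -> nat -> R) :
  \det (\matrix_(i < 4, j < 4) F i j) =
  let m2 i j k l := F i k * F j l - F i l * F j k in
    m2 0 1 0 1 * m2 2 3 2 3 - m2 0 1 0 2 * m2 2 3 1 3
  + m2 0 1 0 3 * m2 2 3 1 2 + m2 0 1 1 2 * m2 2 3 0 3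
  - m2 0 1 1 3 * m2 2 3 0 2 + m2 0 1 2 3 * m2 2 3 0 1.
Proof.
rewrite /= (expand_det_row _ ord0) !big_ord_recl big_ord0.
rewrite /cofactor !(expand_det_row _ ord0) !big_ord_recl !big_ord0.
rewrite /cofactor !(expand_det_row _ ord0) !big_ord_recl !big_ord0.
rewrite /cofactor !det_mx11 !mxE /= /bump /=.
rewrite ?(addn0, add0n, addn1, add1n, expr0).
ring.
Qed.

(** * An explicit numbering of the group *)

Lemma dihedral8_generators : exists x y : 'D_8,
  [/\ #[x] = 4, #[y] = 2, y \notin <[x]> & x ^ y = x^-1]%g.
Proof.
have [[x y] [_ Gx ox yGx] [oy xy]] :=
  @generators_2dihedral _ [set: 'D_8]%G 3 isT (isog_refl _).
by exists x, y; split=> //; case/setDP: yGx.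
Qed.

(* i = 8 e + 4 z + 2 p + r < 16 numbers (e, F ^ p * R ^ (r + 2 z)): the two
   leading binary digits are the coordinates in the central subgroup generated
   by (1, 1) and (0, R ^ 2), so that group matrices have the block shape
   [[A, B], [B, A]] at the two outer levels. *)
Definition rot_exp (i : nat) : nat := (i %% 2 + 2 * (i %/ 4 %% 2))%N.
Definition refl_exp (i : nat) : nat := (i %/ 2 %% 2)%N.
(** Number of the quotient of elements [i] and [j]. Moving a power of R past F inverts it, hence the
    two cases; [+ 4] keeps the subtraction from truncating. *)
Definition div_index (i j : nat) : nat :=
  let n := (if refl_exp j == 0 then rot_exp i + 4 - rot_exp j
            else rot_exp j + 4 - rot_exp i)%N in
  (8 * ((i %/ 8 + j %/ 8) %% 2) + 4 * (n %/ 2 %% 2)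
   + 2 * ((refl_exp i + refl_exp j) %% 2) + n %% 2)%N.

Lemma Z2xD8_numbering : exists h : 'I_16 -> Z2xD8, bijective h /\
  forall i j : 'I_16, (h i * (h j)^-1)%g = h (inord (div_index i j)).
Proof.
have [x [y [ox oy yNx xy]]] := dihedral8_generators.
pose h (i : 'I_16) : Z2xD8 :=
  (inZp (i %/ 8), y ^+ refl_exp i * x ^+ rot_exp i)%g.
have rot4 i : (rot_exp i < 4)%N by rewrite /rot_exp; lia.
have refl2 i : (refl_exp i < 2)%N by rewrite /refl_exp; lia.
have hI : injective h.
  move=> i j [] e12 yx.
  have lt_i := ltn_ord i; have lt_j := ltn_ord j.
  (* Otherwise [y] would be a quotient of two powers of [x]. *)
  have e : refl_exp i = refl_exp j.
    apply/eqP; apply: contraNT yNx.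
    wlog: i j {lt_i lt_j e12} yx / (refl_exp i < refl_exp j)%N => [H|].
      by rewrite neq_ltn => /orP[] lt; [apply: (H i j)|apply: (H j i)];
         rewrite ?lt // neq_ltn lt ?orbT.
    case ri: (refl_exp i) => [|k];
      case rj: (refl_exp j) => [|[|l]] //; last first.
    - by have := refl2 j; rewrite rj.
    - by have := refl2 j; rewrite rj.
    move=> _ _; move: yx; rewrite ri rj mul1g expg1 => yx.
    have -> : y = (x ^+ rot_exp i * (x ^+ rot_exp j)^-1)%g by rewrite yx mulgK.
    by rewrite groupM ?groupV ?mem_cycle.
  move: yx; rewrite e => /mulgI /eqP; rewrite eq_expg_mod_order ox.
  rewrite !modn_small // => /eqP er.
  apply: ord_inj; move: e12 e er; rewrite /refl_exp /rot_exp /=.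
  change (Zp_trunc 2).+2 with 2%N; lia.
exists h; split.
  apply: inj_card_bij hI _.
  by rewrite card_prod !card_ord -cardsT (@card_2dihedral 3).
have y2 n : (y ^+ (n %% 2) = y ^+ n)%g
  by have := expg_mod_order y n; rewrite oy.
have x4 n : (x ^+ (n %% 4) = x ^+ n)%g
  by have := expg_mod_order x n; rewrite ox.
have conjy n : (x ^+ n * y = y * x ^- n)%g by rewrite conjgC conjXg xy expgVn.
have xB n m : (m < 4)%N -> (x ^+ n * x ^- m = x ^+ (n + 4 - m))%g.
  move=> m4; apply: (mulIg (x ^+ m)%g); rewrite mulgKV -expgD.
  rewrite subnK; last by lia.
  by have := expg_order x; rewrite ox expgD => ->; rewrite mulg1.
have mulD p q n m : (q < 2)%N -> (n < 4)%N -> (m < 4)%N ->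
    (y ^+ p * x ^+ n * (y ^+ q * x ^+ m)^-1 = y ^+ ((p + q) %% 2)%N *
     x ^+ ((if q == 0 then n + 4 - m else m + 4 - n) %% 4)%N)%g.
  move=> q2 n4 m4; rewrite y2 x4 invMg.
  case: q q2 => [|[|q]] //= _; first by rewrite addn0 invg1 mulg1 -mulgA xB.
  have yV : (y^-1 = y)%g
    by rewrite -[LHS]mulg1 -(expg_order y) oy expgS expg1 mulKg.
  have conjyV : (x ^- m * y = y * x ^+ m)%g
    by rewrite conjgC conjVg conjXg xy expgVn invgK.
  rewrite expg1 yV conjyV -mulgA [(x ^+ n * _)%g]mulgA conjy expgD expg1.
  rewrite -xB // !mulgA -[RHS]mulgA -[LHS]mulgA; congr (_ * _)%g.
  by apply: commute_sym; apply: commuteV; apply: commuteX2.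
move=> i j; have lt_i := ltn_ord i; have lt_j := ltn_ord j.
have k_lt : (div_index i j < 16)%N by rewrite /div_index; lia.
rewrite /h inordK //; congr (_, _).
  apply: val_inj => /=; change (Zp_trunc 2).+2 with 2%N.
  by rewrite /div_index; case: ifP => _; lia.
rewrite mulD //; congr (_ ^+ _ * _ ^+ _)%g.
  by rewrite /div_index {3}/refl_exp; case: ifP => _; lia.
by rewrite /div_index {5}/rot_exp; case: ifP => _; lia.
Qed.

(** * Factorization of the group determinant *)

(* f n and g n are the coefficients of R ^ n and F * R ^ n. The factor
   Y ^ 2 - 4 Z ^ 2 = (f(1)^2 - g(1)^2) (f(-1)^2 - g(-1)^2) comes from the four
   linear characters and X = |f(i)|^2 - |g(i)|^2 from the 2-dimensional one. *)
Definition d8_det (f g : nat -> int) : int :=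
  let X := (f 0%N - f 2%N) ^+ 2 + (f 1%N - f 3%N) ^+ 2
           - (g 0%N - g 2%N) ^+ 2 - (g 1%N - g 3%N) ^+ 2 in
  let Y := (f 0%N + f 2%N) ^+ 2 + (f 1%N + f 3%N) ^+ 2
           - (g 0%N + g 2%N) ^+ 2 - (g 1%N + g 3%N) ^+ 2 in
  let Z := (f 0%N + f 2%N) * (f 1%N + f 3%N)
           - (g 0%N + g 2%N) * (g 1%N + g 3%N) in
  X ^+ 2 * (Y ^+ 2 - 4 * Z ^+ 2).

(** The number of (e, F ^ p * R ^ n), for n < 4. *)
Definition coset_index (e p n : nat) : nat :=
  (8 * e + 4 * (n %/ 2) + 2 * p + n %% 2)%N.

Lemma div_index_add8 i j : (i < 8)%N -> (j < 8)%N ->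
  [/\ div_index (8 + i) (8 + j) = div_index i j,
      div_index (8 + i) j = div_index i (8 + j)
    & div_index i (8 + j) = (8 + div_index i j)%N].
Proof.
move=> hi hj.
have rot8 k : rot_exp (8 + k) = rot_exp k by rewrite /rot_exp; lia.
have refl8 k : refl_exp (8 + k) = refl_exp k by rewrite /refl_exp; lia.
rewrite /div_index !rot8 !refl8 !divnDl // !(divn_small hi) !(divn_small hj).
by rewrite divnn -!addnA.
Qed.

(** Splitting along R ^ 2: the block where it acts as 1 gives the linear characters, the block where
    it acts as -1 gives X ^ 2. *)
Lemma det_div_index8 (c : nat -> int) :
  \det (\matrix_(i < 8, j < 8) c (div_index i j)) =
  d8_det (fun n => c (coset_index 0 0 n)) (fun n => c (coset_index 0 1 n)).
Proof.
have E := @det_split _ 4 (fun i j => c (div_index i j)).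
rewrite {}E; last by case=> [|[|[|[|i]]]] // [|[|[|[|j]]]].
have E := @det4E int.
rewrite (E (fun i j => c (div_index i j) + c (div_index i (4 + j)))).
rewrite (E (fun i j => c (div_index i j) - c (div_index i (4 + j)))).
rewrite /d8_det.
(* Indices are evaluated so that [ring] sees equal coefficients as equal atoms. *)
repeat match goal with |- context[c ?k] =>
  let w := eval vm_compute in k in progress change (c k) with (c w) end.
rewrite mulrC; congr (_ * _); ring.
Qed.

Lemma det_div_index16 (c : nat -> int) :
  let u p n := c (coset_index 0 p n) in let v p n := c (coset_index 1 p n) in
  \det (\matrix_(i < 16, j < 16) c (div_index i j)) =
  d8_det (fun n => u 0%N n + v 0%N n) (fun n => u 1%N n + v 1%N n) *
  d8_det (fun n => u 0%N n - v 0%N n) (fun n => u 1%N n - v 1%N n).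
Proof.
move=> u v.
have E := @det_split _ 8 (fun i j => c (div_index i j)).
rewrite {}E; last by move=> i j hi hj; have [-> ->] := div_index_add8 hi hj.
rewrite -(det_div_index8 (fun k => c k + c (8 + k)%N)).
rewrite -(det_div_index8 (fun k => c k - c (8 + k)%N)).
by congr (_ * _); congr (\det _); apply/matrixP=> i j; rewrite !mxE;
  have [_ _ ->] := div_index_add8 (ltn_ord i) (ltn_ord j).
Qed.

(** The pairs (u + v, u - v) are exactly the pairs in Z[D_8] congruent modulo 2. *)
Lemma integer_group_det_Z2xD8 (d : int) :
  integer_group_det Z2xD8 d <->
  exists f g s t : nat -> int,
    d = d8_det f g * d8_det (fun n => f n + 2 * s n) (fun n => g n + 2 * t n).
Proof.
have [h [hbij hdiv]] := Z2xD8_numbering.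
have detE (a : {ffun Z2xD8 -> int}) (c : nat -> int) :
    (forall i : 'I_16, a (h i) = c i) ->
    group_det a = \det (\matrix_(i < 16, j < 16) c (div_index i j)).
  move=> ac; rewrite (group_det_reindex a hbij); congr (\det _).
  apply/matrixP=> i j; rewrite !mxE hdiv ac inordK //.
  have := ltn_ord i; have := ltn_ord j; rewrite /div_index; lia.
split=> [[a <-]|[f [g [s [t ->]]]]].
  pose c k := a (h (inord k)).
  rewrite (detE a c) => [|i]; last by rewrite /c inord_val.
  rewrite det_div_index16.
  exists (fun n => c (coset_index 0 0 n) + c (coset_index 1 0 n)),
    (fun n => c (coset_index 0 1 n) + c (coset_index 1 1 n)),
    (fun n => - c (coset_index 1 0 n)), (fun n => - c (coset_index 1 1 n)).
  by congr (_ * _); rewrite /d8_det; ring.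
have [h' hK h'K] := hbij.
(* This solves for u and v: u is (f + s, g + t) and v is (- s, - t). *)
pose c k := let n := rot_exp k in
  let w := if refl_exp k == 0%N then s n else t n in
  if (k < 8)%N then (if refl_exp k == 0%N then f n else g n) + w else - w.
exists [ffun x => c (h' x)].
rewrite (detE _ c) => [|i]; last by rewrite ffunE hK.
rewrite det_div_index16 /d8_det /c /=; congr (_ * _); ring.
Qed.

(** * Congruence modulo 16 and divisibility by 2 ^ 8 *)

Lemma int_parity (n : int) : exists k, n = 2 * k \/ n = 2 * k + 1.
Proof. by exists (n %/ 2)%Z; lia. Qed.

(* X * Y is unchanged modulo 8 and X * Z modulo 2. *)
Lemma mod16_step (X x w v Z z : int) :
  let Y := X + 2 * w in let y := x + 2 * v in
  exists k, (X + 4 * x) ^+ 2 * ((Y + 4 * y) ^+ 2 - 4 * (Z + 2 * z) ^+ 2) =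
            X ^+ 2 * (Y ^+ 2 - 4 * Z ^+ 2) + 16 * k.
Proof.
move=> Y y.
(* (X + 4 x)(Y + 4 y) = X Y + 8 h and (X + 4 x)(Z + 2 z) = X Z + 2 q. *)
pose h := x * X + x * w + v * X + 2 * x * y.
pose q := X * z + 2 * x * Z + 4 * x * z.
exists (X * Y * h + 4 * h ^+ 2 - X * Z * q - q ^+ 2).
rewrite /h /q /y /Y; ring.
Qed.

Lemma d8_det_mod16 (f g s t : nat -> int) :
  exists k, d8_det (fun n => f n + 2 * s n) (fun n => g n + 2 * t n) =
            d8_det f g + 16 * k.
Proof.
(* A quarter of the increment of (u a - u b) ^ 2 when 2 v is added to u. *)
pose sq a b (u v : nat -> int) :=
  (u a - u b) * (v a - v b) + (v a - v b) ^+ 2.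
have [k] := mod16_step
  ((f 0%N - f 2%N) ^+ 2 + (f 1%N - f 3%N) ^+ 2
   - (g 0%N - g 2%N) ^+ 2 - (g 1%N - g 3%N) ^+ 2)
  (sq 0%N 2%N f s + sq 1%N 3%N f s - sq 0%N 2%N g t - sq 1%N 3%N g t)
  (2 * (f 0%N * f 2%N + f 1%N * f 3%N - g 0%N * g 2%N - g 1%N * g 3%N))
  (f 0%N * s 2%N + f 2%N * s 0%N + 2 * s 0%N * s 2%N
   + f 1%N * s 3%N + f 3%N * s 1%N + 2 * s 1%N * s 3%N
   - g 0%N * t 2%N - g 2%N * t 0%N - 2 * t 0%N * t 2%N
   - g 1%N * t 3%N - g 3%N * t 1%N - 2 * t 1%N * t 3%N)
  ((f 0%N + f 2%N) * (f 1%N + f 3%N) - (g 0%N + g 2%N) * (g 1%N + g 3%N))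
  ((f 0%N + f 2%N) * (s 1%N + s 3%N) + (s 0%N + s 2%N) * (f 1%N + f 3%N)
   + 2 * (s 0%N + s 2%N) * (s 1%N + s 3%N)
   - (g 0%N + g 2%N) * (t 1%N + t 3%N) - (t 0%N + t 2%N) * (g 1%N + g 3%N)
   - 2 * (t 0%N + t 2%N) * (t 1%N + t 3%N)).
rewrite /sq => E; exists k; rewrite /d8_det.
apply: etrans (etrans E _).
  by congr (_ ^+ 2 * (_ ^+ 2 - 4 * _ ^+ 2)); ring.
by congr (_ ^+ 2 * (_ ^+ 2 - _) + _); ring.
Qed.

(* If p is odd then M and N are even; if p is even then 4 divides M, or 4
   divides N, or M and N are both odd. *)
Lemma four_dvd_core (k l p r w : int) :
  let M := k * (p + k) in let N := l * (p + 2 * r + l) in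
  exists z, M * N * (M + N + 2 * w) ^+ 2 = 4 * z.
Proof.
move=> M N.
have even_mul (n m : int) : exists a, n * (2 * m + 1 + n) = 2 * a.
  have [n' [->|->]] := int_parity n.
    by exists (n' * (2 * m + 1 + 2 * n')); ring.
  by exists ((2 * n' + 1) * (m + 1 + n')); ring.
have [p' [pE|pE]] := int_parity p; last first.
  have [a aE] := even_mul k p'; have [b bE] := even_mul l (p' + r).
  exists (a * b * (M + N + 2 * w) ^+ 2).
  have -> : N = 2 * b by rewrite -bE /N pE; ring.
  by rewrite {1}/M pE aE; ring.
have [k' [kE|kE]] := int_parity k.
  exists (k' * (p' + k') * N * (M + N + 2 * w) ^+ 2).
  by rewrite {1}/M kE pE; ring.
have [l' [lE|lE]] := int_parity l.
  exists (M * (l' * (p' + r + l')) * (M + N + 2 * w) ^+ 2).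
  by rewrite {1}/N lE pE; ring.
(* M and N are odd here, so M + N + 2 w = 2 h and its square supplies the 4. *)
pose h := 2 * k' ^+ 2 + 2 * k' + 1 + 2 * k' * p' + p' + 2 * l' ^+ 2 + 2 * l'
          + (2 * l' + 1) * (p' + r) + w.
exists (M * N * h ^+ 2).
have -> : M + N + 2 * w = 2 * h by rewrite /M /N /h kE lE pE; ring.
ring.
Qed.

(* Setting g(1) = f(1) + 2 k and g(-1) = f(-1) + 2 l gives
   d8_det f g = 64 M N (M + N + 2 W) ^ 2 with M = k (f(1) + k) and
   N = l (f(-1) + l). *)
Lemma d8_det_even (f g : nat -> int) :
  (2 %| d8_det f g)%Z -> (2 ^+ 8 %| d8_det f g)%Z.
Proof.
pose W := f 0%N * f 2%N + f 1%N * f 3%N - g 0%N * g 2%N - g 1%N * g 3%N.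
have -> : d8_det f g = let e := f 0%N + f 2%N in let o := f 1%N + f 3%N in
    let E := g 0%N + g 2%N in let O := g 1%N + g 3%N in
    let Y := e ^+ 2 + o ^+ 2 - E ^+ 2 - O ^+ 2 in
    (Y - 4 * W) ^+ 2 * (Y ^+ 2 - 4 * (e * o - E * O) ^+ 2).
  rewrite /d8_det /W /=; ring.
move: (f 0%N + _) (f 1%N + _) (g 0%N + _) (g 1%N + _) W => e o E O W /=.
have [k [kE|kE]] := int_parity (E + O - e - o).
  have {kE} -> : O = e + o + 2 * k - E by lia.
  (* p = f(1) = e + o and p + 2 r = f(-1) = e - o. *)
  have [z zE] := four_dvd_core k (E - e - k) (e + o) (- o) W.
  move=> _; apply/dvdzP; exists z.
  transitivity (64 * (4 * z)); last by ring.
  rewrite -zE; ring.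
(* Here Y is odd, so the determinant is odd, against the hypothesis. *)
have {kE} OE : O = e + o + 2 * k + 1 - E by lia.
pose y := E * O - e * o - (2 * k + 1) * (e + o) - 2 * k ^+ 2 - 2 * k - 1.
have -> : e ^+ 2 + o ^+ 2 - E ^+ 2 - O ^+ 2 = 2 * y + 1.
  by rewrite /y OE; ring.
move: y (e * o - E * O) => y Z.
pose a := (y - 2 * W) ^+ 2 + (y - 2 * W).
pose b := y ^+ 2 + y - Z ^+ 2.
have -> : (2 * y + 1 - 4 * W) ^+ 2 * ((2 * y + 1) ^+ 2 - 4 * Z ^+ 2) =
    2 * (8 * a * b + 2 * a + 2 * b) + 1.
  by rewrite /a /b; ring.
by move: (8 * a * b + _ + _) => c; lia.
Qed.

(** * Explicit elements realising the values *)

Definition coefs (s : seq int) (n : nat) : int := nth 0 s n.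

Lemma d8_det_family_odd (m k : int) : odd_int m ->
  exists f g s t : nat -> int,
    m * (m + 16 * k) =
      d8_det f g * d8_det (fun n => f n + 2 * s n) (fun n => g n + 2 * t n).
Proof.
rewrite /odd_int /even_int => mo.
have one_mod4 (j l : int) : exists f g s t : nat -> int,
    (4 * j + 1) * (4 * j + 1 + 16 * l) =
      d8_det f g * d8_det (fun n => f n + 2 * s n) (fun n => g n + 2 * t n).
  (* X = 1 or -1, f(-1) = 1 and g(-1) = 0, so the value is f(1) ^ 2 - g(1) ^ 2, that is 8 i + 1 or 8
     i + 5. Adding 2 l to all coefficients turns i into i + 2 l. *)
  have [i [->|->]] := int_parity j.
    exists (coefs [:: i + 1; i; i; i]), (fun=> i), (fun=> l), (fun=> l).
    by rewrite /d8_det /coefs /=; ring.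
  exists (coefs [:: i + 1; i + 1; i + 1; i]), (coefs [:: i + 1; i + 1; i; i]),
    (fun=> l), (fun=> l).
  by rewrite /d8_det /coefs /=; ring.
have [j [jE|jE]] : exists j, m = 4 * j + 1 \/ m = - (4 * j + 1).
- have [q [qE|qE]] := int_parity m; first by lia.
  have [i [iE|iE]] := int_parity q; first by exists i; lia.
  by exists (- i - 1); lia.
- by rewrite jE; apply: one_mod4.
have [f [g [s [t E]]]] := one_mod4 j (- k).
by exists f, g, s, t; rewrite -E jE; ring.
Qed.

Lemma d8_det_family_even (m : int) : exists f g s t : nat -> int,
    2 ^+ 16 * m =
      d8_det f g * d8_det (fun n => f n + 2 * s n) (fun n => g n + 2 * t n).
Proof.
(* X = 2, f(1) = 2 and f(-1) = 4 give the value 2 ^ 8. *)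
exists (coefs [:: 2; 0; 1; - 1]), (fun=> 0).
have [r [->|->]] := int_parity m; last first.
  (* For odd m, i multiplies an alternating sum, so only the factor at -1 varies. *)
  have [i [->|->]] := int_parity r.
    exists (coefs [:: i; - i; i; - i]), (coefs [:: i; - i; i; - i]).
    by rewrite /d8_det /coefs /=; ring.
  exists (coefs [:: i + 1; - i - 1; i; - i]),
    (coefs [:: i + 1; - i; i; - i - 1]).
  by rewrite /d8_det /coefs /=; ring.
(* For even m, i shifts all coefficients, so only the factor at 1 varies; the factor at -1 is -4,
   hence the sign. *)
have -> : r = - - r by rewrite opprK.
have [i [->|->]] := int_parity (- r).
  exists (coefs [:: i - 1; i; i; i + 1]), (coefs [:: i; i; i; i - 1]).
  by rewrite /d8_det /coefs /=; ring.
exists (coefs [:: i; i + 1; i; i + 1]), (coefs [:: i + 1; i; i; i]).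
by rewrite /d8_det /coefs /=; ring.
Qed.

(** * Determination of the odd and the even values *)

Theorem theorem3p1 :
  (forall d : int,
     (integer_group_det Z2xD8 d /\ odd_int d) <->
     (exists m k : int, odd_int m /\ d = m * (m + 16 * k)))
  /\
  (forall d : int,
     (integer_group_det Z2xD8 d /\ even_int d) <->
     (exists m : int, d = 2 ^+ 16 * m)).
Proof.
split=> d; split.
- case=> /integer_group_det_Z2xD8[f [g [s [t ->]]]].
  have [k ->] := d8_det_mod16 f g s t; move: (d8_det f g) => m od.
  exists m, k; split=> //; apply: contra od.
  by rewrite /even_int => /dvdz_mulr.
- case=> m [k [om ->]]; split; last first.
    move: om; rewrite /odd_int /even_int => om.
    have -> : m * (m + 16 * k) = m ^+ 2 + 2 * (8 * k * m) by ring.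
    have [q [E|E]] := int_parity m; first by lia.
    have -> : m ^+ 2 = 2 * (2 * q ^+ 2 + 2 * q) + 1 by rewrite E; ring.
    by lia.
  by apply/integer_group_det_Z2xD8/d8_det_family_odd.
- case=> /integer_group_det_Z2xD8[f [g [s [t ->]]]] ed.
  have [k kE] := d8_det_mod16 f g s t.
  (* The two factors have the same parity, so an even product makes both even. *)
  have ev : (2 %| d8_det f g)%Z.
    move: ed; rewrite /even_int kE; move: (d8_det f g) => m.
    have [q [->|->]] := int_parity m; first by lia.
    have -> : (2 * q + 1) * (2 * q + 1 + 16 * k) =
      2 * (2 * q ^+ 2 + 2 * q + 8 * k * (2 * q + 1)) + 1 by ring.
    by lia.
  have /dvdzP[a ->] := d8_det_even ev.
  have /dvdzP[b ->] : (2 ^+ 8 %|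
      d8_det (fun n => f n + 2 * s n) (fun n => g n + 2 * t n))%Z.
    by apply: d8_det_even; rewrite kE; lia.
  by exists (a * b); ring.
- case=> m ->; split; last by rewrite /even_int dvdz_mulr // dvdz_exp.
  by apply/integer_group_det_Z2xD8/d8_det_family_even.
Qed.
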